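(* For any integer $d\ge0$, the assignment $\mathrm{PD}_d:\mathrm{Fil}\to\mathrm{Dgm}$, $F\mapsto\mathrm{PD}_d^F$, is a functor, where a morphism $(f,g,Z,\pi_V,\pi_W)$ of $\mathrm{Fil}$ is sent to the Galois connection $f:Q\leftrightarrows R:g$. Moreover, $$d^E_{\mathrm{Dgm}}(\mathrm{PD}_d^F,\mathrm{PD}_d^G)\le d^E_{\mathrm{Fil}}(F,G)$$ for any $F$ and $G$ in $\mathrm{Fil}$.
   Context: **Galois connections and intervals.** A Galois connection $f:Q\leftrightarrows R:g$ is a pair of order-preserving maps with $f(q)\le r\iff q\le g(r)$. For a poset $Q$, $\bar Q=\{[q_1,q_2]:q_1\le q_2\}$ with the product order ($[q_1,q_2]\le[q_3,q_4]$ iff $q_1\le q_3,q_2\le q_4$), $\mathrm{diag}(\bar Q)=\{[q,q]:q\in Q\}$, and $\bar f([q_1,q_2])=[f(q_1),f(q_2)]$. **Fil.** A 1-parameter filtration is an order-preserving map $F:Q\to\mathrm{SubCx}(K_V)$ with $Q\subseteq[0,\infty)$ finite, $0\in Q$, $K_V$ a simplicial complex with finite vertex set $V$, $\mathrm{SubCx}(K_V)$ the poset of its subcomplexes, $F(\max Q)=K_V$. For a finite set $Z$ and a surjection $\pi:Z\to V$, the pullback filtration $F_Z^\pi$ sends $q$ to the smallest simplicial complex on $Z$ containing $\{\pi^{-1}(\sigma):\sigma\in F(q)\}$. Objects of $\mathrm{Fil}$: 1-parameter filtrations. A morphism from $F:Q\to\mathrm{SubCx}(K_V)$ to $G:R\to\mathrm{SubCx}(K_W)$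 is a tuple $(f,g,Z,\pi_V,\pi_W)$ with $Z$ a finite set, $\pi_V:Z\to V$, $\pi_W:Z\to W$ surjections, $f:Q\leftrightarrows R:g$ a Galois connection and $G_Z^{\pi_W}(r)=F_Z^{\pi_V}(g(r))$ for all $r\in R$. Tuples with the same $(f,g)$ whose sets $Z,Z'$ are related by a bijection compatible with the surjections are identified; the composite of $(f,g,Z,\pi_V,\pi_W)$ with $(f',g',Z',\pi'_W,\pi'_U)$ is $(f'\circ f,g\circ g',Z\times_WZ',\pi_V\circ\mathrm{pr}_1,\pi'_U\circ\mathrm{pr}_2)$. Cost: $\max_{q_1,q_2\in Q}\big||q_1-q_2|-|f(q_1)-f(q_2)|\big|$. **Dgm.** A persistence diagram is a function $\sigma:\bar Q\to\mathbb N$ with $Q\subseteq[0,\infty)$ finite, $0\in Q$. A morphism from $\sigma:\bar Q\to\mathbb N$ to $\tau:\bar R\to\mathbb N$ is a Galois connection $f:Q\leftrightarrows R:g$ with $\tau(J)=\sum_{I\in\bar Q,\bar f(I)=J}\sigma(I)$ for all $J\in\bar R\setminus\mathrm{diag}(\bar R)$. Cost: $\max_{I,J\in\bar Q}\big|\|I-J\|_\infty-\|\bar f(I)-\bar f(J)\|_\infty\big|$, where $[q_1,q_2]-[q_3,q_4]=(q_1-q_3,q_2-q_4)\in\mathbb R^2$. **Persistence diagram of a filtration.** Fix a field $\Bbbk$. With $Z_d$, $B_d$ simplicial $d$-cycles and $d$-boundaries over $\Bbbk$, regarded as subspaces of the $d$-th chain space of $K_V$, $\mathrm{ZB}_d^F([q_i,q_j])=\dim(Z_d(F(q_i))\cap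 B_d(F(q_j)))$ for $[q_i,q_j]\in\bar Q$; $\mathrm{PD}_d^F:\bar Q\to\mathbb Z$ is its Möbius inverse, the unique function with $\mathrm{ZB}_d^F(I)=\sum_{I'\le I}\mathrm{PD}_d^F(I')$ for all $I\in\bar Q$. It is known to take values in $\mathbb N$. **Edit distance.** $d^E_{\mathcal C}(A,B)$ is the infimum (with $\inf\emptyset=+\infty$) of the costs of all finite sequences of morphisms $A\leftrightarrow D_1\leftrightarrow\cdots\leftrightarrow D_{k-1}\leftrightarrow B$ of $\mathcal C$ (each in either direction), the cost of a sequence being the sum of the costs of its morphisms. *)

(* Defs.v *)
From HB Require Import structures.
From mathcomp Require Import all_boot all_order all_algebra finmap.
From mathcomp Require Import boolp classical_sets reals constructive_ereal ereal.
From mathcomp Require Import fintype finset.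

Set Implicit Arguments.
Unset Strict Implicit.
Unset Printing Implicit Defensive.

Import Order.TTheory GRing.Theory Num.Theory.

Local Open Scope ring_scope.

(* [cat_eq] plays the role of equality of morphisms: a morphism from A to B   *)
(* is a [cat_eq]-class in [cat_hom A B].  Composition is diagrammatic.        *)
Record category := Category {
  cat_obj :> Type;
  cat_hom : cat_obj -> cat_obj -> Type;
  cat_eq : forall A B, cat_hom A B -> cat_hom A B -> Prop;
  cat_id : forall A, cat_hom A A;
  cat_comp : forall A B C, cat_hom A B -> cat_hom B C -> cat_hom A C;
  cat_eq_refl : forall A B (m : cat_hom A B), cat_eq m m;
  cat_eq_sym : forall A B (m n : cat_hom A B), cat_eq m n -> cat_eq n m;
  cat_eq_trans : forall A B (m n p : cat_hom A B),
    cat_eq m n -> cat_eq n p -> cat_eq m p;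
  cat_comp_eq : forall A B C (m m' : cat_hom A B) (n n' : cat_hom B C),
    cat_eq m m' -> cat_eq n n' -> cat_eq (cat_comp m n) (cat_comp m' n');
  cat_comp_idl : forall A B (m : cat_hom A B), cat_eq (cat_comp (cat_id A) m) m;
  cat_comp_idr : forall A B (m : cat_hom A B), cat_eq (cat_comp m (cat_id B)) m;
  cat_compA : forall A B C D (m : cat_hom A B) (n : cat_hom B C) (p : cat_hom C D),
    cat_eq (cat_comp m (cat_comp n p)) (cat_comp (cat_comp m n) p) }.

Arguments cat_id {c} A.

Record is_functor (C D : category) (Fo : C -> D)
    (Fm : forall A B : C, cat_hom A B -> cat_hom (Fo A) (Fo B)) : Prop := IsFunctor {
  functor_eq : forall (A B : C) (m n : cat_hom A B),
    cat_eq m n -> cat_eq (Fm A B m) (Fm A B n);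
  functor_id : forall A : C, cat_eq (Fm A A (cat_id A)) (cat_id (Fo A));
  functor_comp : forall (A B E : C) (m : cat_hom A B) (n : cat_hom B E),
    cat_eq (Fm A E (cat_comp m n)) (cat_comp (Fm A B m) (Fm B E n)) }.

Section EditDistance.
Variables (R : realType) (C : category) (cost : forall A B : C, cat_hom A B -> R).

Inductive step (A B : C) : Type :=
| forward of cat_hom A B
| backward of cat_hom B A.

Inductive zigzag (A B : C) : Type :=
| one_step of step A B
| more_steps (D : C) of step A D & zigzag D B.

Definition step_cost A B (s : step A B) : R :=
  match s with forward m => cost m | backward m => cost m end.

Fixpoint zigzag_cost A B (z : zigzag A B) : R :=
  match z with
  | one_step s => step_cost s
  | more_steps _ s z' => step_cost s + zigzag_cost z'
  end.

Definition edit_dist (A B : C) : \bar R :=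
  ereal_inf [set c : \bar R | exists z : zigzag A B, c = (zigzag_cost z)%:E]%classic.

End EditDistance.

Section Galois.
Local Open Scope order_scope.

Record galois d d' (P : porderType d) (Q : porderType d') := Galois {
  gal_l :> P -> Q;
  gal_r : Q -> P;
  gal_l_homo : {homo gal_l : x y / x <= y};
  gal_r_homo : {homo gal_r : x y / x <= y};
  galP : forall p q, (gal_l p <= q) = (p <= gal_r q) }.

Definition gal_id d (P : porderType d) : galois P P :=
  @Galois _ _ P P id id (fun _ _ h => h) (fun _ _ h => h) (fun _ _ => erefl).

Lemma gal_comp_subproof d d' d'' (P : porderType d) (Q : porderType d')
    (S : porderType d'') (f : galois P Q) (g : galois Q S) p s :
  (g (f p) <= s) = (p <= gal_r f (gal_r g s)).
Proof. by rewrite galP galP. Qed.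

Definition gal_comp d d' d'' (P : porderType d) (Q : porderType d')
    (S : porderType d'') (f : galois P Q) (g : galois Q S) : galois P S :=
  @Galois _ _ P S (fun p => g (f p)) (fun s => gal_r f (gal_r g s))
    (fun x y h => gal_l_homo g (gal_l_homo f h))
    (fun x y h => gal_r_homo f (gal_r_homo g h))
    (gal_comp_subproof f g).

Definition gal_eq d d' (P : porderType d) (Q : porderType d')
    (f g : galois P Q) : Prop :=
  gal_l f =1 gal_l g /\ gal_r f =1 gal_r g.

End Galois.

Fact interval_display (d : Order.disp_t) : Order.disp_t.
Proof. exact: d. Qed.

Section Interval.
Local Open Scope order_scope.
Variables (d : Order.disp_t) (Q : finPOrderType d).

Record interv := Interv {
  interv_val :> Q * Q;
  interv_le : interv_val.1 <= interv_val.2 }.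

HB.instance Definition _ := [isSub for interv_val].
HB.instance Definition _ := [Finite of interv by <:].

Definition lo (I : interv) : Q := I.1.
Definition hi (I : interv) : Q := I.2.

Definition le_interv (I J : interv) : bool := (lo I <= lo J) && (hi I <= hi J).

Lemma le_interv_refl : reflexive le_interv.
Proof. by move=> I; rewrite /le_interv !lexx. Qed.

Lemma le_interv_anti : antisymmetric le_interv.
Proof.
move=> I J /andP[/andP[h1 h2] /andP[h3 h4]]; apply: val_inj.
rewrite /= [interv_val I]surjective_pairing [interv_val J]surjective_pairing.
by congr pair; apply: le_anti; rewrite ?h1 ?h2.
Qed.

Lemma le_interv_trans : transitive le_interv.
Proof.
move=> I J K /andP[h1 h2] /andP[h3 h4].
by rewrite /le_interv (le_trans h1 h3) (le_trans h2 h4).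
Qed.

HB.instance Definition _ := Order.Le_isPOrder.Build (interval_display d) interv
  le_interv_refl le_interv_anti le_interv_trans.

Definition diag : {set interv} := [set I | lo I == hi I].

End Interval.

Definition gal_bar d d' (P : finPOrderType d) (Q : finPOrderType d')
    (f : galois P Q) (I : interv P) : interv Q :=
  @Interv _ Q (f (lo I), f (hi I)) (gal_l_homo f (interv_le I)).

Section Mobius.
Local Open Scope order_scope.
Variables (d : Order.disp_t) (T : finPOrderType d) (h : T -> int).

(* The first argument is fuel; #|T| is enough by [mobius_invP].               *)
Fixpoint mobius_rec (n : nat) (x : T) : int :=
  (if n is n'.+1 then h x - \sum_(y | (y < x)%O) mobius_rec n' y else 0)%R.

Definition mobius_inv (x : T) : int := mobius_rec #|T| x.

Lemma mobius_rec_stable n m x :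
  (#|[set y : T | (y <= x)%O]| <= n)%N -> (#|[set y : T | (y <= x)%O]| <= m)%N ->
  mobius_rec n x = mobius_rec m x.
Proof.
have cpos (z : T) : (0 < #|[set y : T | (y <= z)%O]|)%N.
  by apply/card_gt0P; exists z; rewrite inE.
elim: n m x => [|n IH] m x.
  by move=> h0; have := leq_trans (cpos x) h0.
case: m => [|m] hn hm; first by have := leq_trans (cpos x) hm.
rewrite /=; congr (_ - _)%R; apply: eq_bigr => y yx.
have lt : (#|[set z : T | (z <= y)%O]| < #|[set z | (z <= x)%O]|)%N.
  apply/proper_card/properP; split.
    by apply/subsetP=> z; rewrite !inE => zy; apply: le_trans zy (ltW yx).
  by exists x; rewrite !inE // lt_geF.
by apply: IH; rewrite -ltnS; apply: leq_trans lt _.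
Qed.

Lemma mobius_invP x : h x = (\sum_(y | (y <= x)%O) mobius_inv y)%R.
Proof.
rewrite (bigD1 x) //= {1}/mobius_inv.
have -> : mobius_rec #|T| x = mobius_rec #|T|.+1 x.
  by apply: mobius_rec_stable; [|apply: leq_trans (leqnSn _)]; exact: max_card.
rewrite /= addrC.
rewrite [X in (X + _)%R](eq_bigl (fun y => (y < x)%O)).
  by rewrite addrC subrK.
by move=> y; rewrite lt_neqAle andbC.
Qed.

Lemma mobius_inv_uniq (g : T -> int) :
  (forall x, h x = (\sum_(y | (y <= x)%O) g y)%R) -> g =1 mobius_inv.
Proof.
move=> hg x.
have [n] := ubnP #|[set y : T | (y <= x)%O]|; elim: n x => // n IH x hn.
have := hg x; rewrite (mobius_invP x) (bigD1 x) //= [RHS](bigD1 x) //=.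
rewrite (eq_bigr g); first by move/addIr.
move=> y /andP[yx ynx]; apply/esym/IH; rewrite -ltnS; apply: leq_ltn_trans hn.
apply/proper_card/properP; split.
  by apply/subsetP=> z; rewrite !inE => zy; apply: le_trans zy yx.
by exists x; rewrite !inE // lt_geF // lt_neqAle ynx.
Qed.

End Mobius.

Section Grid.
Variable R : realType.

HB.instance Definition _ (Q : {fset R}) :=
  [SubChoice_isSubOrder of fset_sub_type Q by <: with ring_display].

Record grid := Grid {
  grid_pts :> {fset R};
  grid_ge0 : forall x, x \in grid_pts -> 0 <= x;
  grid0 : 0 \in grid_pts }.

End Grid.


Section Diagrams.
Variable R : realType.

Record diagram := Diagram {
  dgm_idx : grid R;
  dgm_mult :> interv dgm_idx -> nat }.

Record dgm_hom (s t : diagram) := DgmHom {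
  dgm_gal :> galois (dgm_idx s) (dgm_idx t);
  dgm_homP : forall J : interv (dgm_idx t), J \notin diag (dgm_idx t) ->
    t J = (\sum_(I : interv (dgm_idx s) | gal_bar dgm_gal I == J) s I)%N }.

Definition dgm_heq (s t : diagram) (m n : dgm_hom s t) : Prop := gal_eq m n.

Lemma dgm_id_subproof (s : diagram) (J : interv (dgm_idx s)) :
  J \notin diag (dgm_idx s) ->
  s J = (\sum_(I : interv (dgm_idx s) | gal_bar (gal_id (dgm_idx s)) I == J) s I)%N.
Proof.
by move=> _; rewrite (big_pred1 J) // => -[[q1 q2] q12] /=; rewrite -val_eqE.
Qed.

Definition dgm_id (s : diagram) : dgm_hom s s :=
  DgmHom (@dgm_id_subproof s).

Lemma dgm_comp_subproof (s t u : diagram) (m : dgm_hom s t) (n : dgm_hom t u)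
    (K : interv (dgm_idx u)) : K \notin diag (dgm_idx u) ->
  u K = (\sum_(I : interv (dgm_idx s) | gal_bar (gal_comp m n) I == K) s I)%N.
Proof.
move=> Knd; rewrite (dgm_homP n Knd).
rewrite (partition_big (gal_bar m) (fun J => gal_bar n J == K)) /=; last first.
  by move=> I /eqP <-; apply/eqP/val_inj.
apply: eq_bigr => J /eqP JK; rewrite (dgm_homP m); last first.
  apply: contra Knd; rewrite -JK !inE /lo /hi /=.
  by rewrite /lo /hi => /eqP ->.
apply: eq_bigl => I; apply/idP/andP => [/eqP IJ|[]//]; split; last exact/eqP.
by rewrite -JK -IJ; apply/eqP/val_inj.
Qed.

Definition dgm_comp (s t u : diagram) (m : dgm_hom s t) (n : dgm_hom t u) :
  dgm_hom s u := DgmHom (dgm_comp_subproof m n).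

Definition Dgm : category.
Proof.
apply: (@Category diagram dgm_hom dgm_heq dgm_id dgm_comp).
- by [].
- by move=> A B m n [h1 h2]; split=> x; rewrite ?h1 ?h2.
- by move=> A B m n p [h1 h2] [h3 h4]; split=> x; rewrite ?h1 ?h2 ?h3 ?h4.
- by move=> A B C m m' n n' [h1 h2] [h3 h4]; split=> x /=;
    rewrite ?h1 ?h2 ?h3 ?h4.
- by [].
- by [].
- by [].
Defined.

Definition interv_dist (Q : grid R) (I J : interv Q) : R :=
  Num.max `|val (lo I) - val (lo J)| `|val (hi I) - val (hi J)|.

Definition dgm_cost (s t : Dgm) (m : cat_hom s t) : R :=
  \big[Num.max/0]_(I : interv (dgm_idx s)) \big[Num.max/0]_(J : interv (dgm_idx s))
    `|interv_dist I J - interv_dist (gal_bar (m : dgm_hom s t) I)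
                                    (gal_bar (m : dgm_hom s t) J)|.

End Diagrams.

Section Complexes.
Variable V : finType.

(* Simplices are nonempty, and a vertex of V need not be a simplex.           *)
Definition is_complex (K : {set {set V}}) : bool :=
  (set0 \notin K) &&
  [forall s in K, forall t : {set V}, (t != set0) && (t \subset s) ==> (t \in K)].

Lemma is_complexP (K : {set {set V}}) :
  reflect (set0 \notin K /\
           forall s t : {set V}, s \in K -> t != set0 -> t \subset s -> t \in K)
          (is_complex K).
Proof.
apply: (iffP andP) => -[h0 h]; split=> //.
  move=> s t sK t0 ts; move/forall_inP/(_ s sK)/forallP/(_ t): h.
  by rewrite t0 ts.
by apply/forall_inP=> s sK; apply/forallP=> t; apply/implyP=> /andP[]; exact: h.
Qed.

End Complexes.

(* The intersection of all complexes on Z containing the preimages, i.e. the  *)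
(* smallest such complex.                                                     *)
Definition pullback (V Z : finType) (p : Z -> V) (K : {set {set V}}) :
    {set {set Z}} :=
  \bigcap_(L : {set {set Z}} | is_complex L && [forall s in K, p @^-1: s \in L]) L.

Lemma pullbackP (V Z : finType) (p : Z -> V) (K : {set {set V}}) (t : {set Z}) :
  is_complex K -> (forall v, exists z, p z = v) ->
  (t \in pullback p K) = (t != set0) && (p @: t \in K).
Proof.
move=> /is_complexP[K0 Kdown] psurj; apply/bigcapP/andP.
  move=> /(_ [set t : {set Z} | (t != set0) && (p @: t \in K)]).
  rewrite inE => h; apply/andP; apply: h; apply/andP; split.
    apply/is_complexP; split; first by rewrite inE eqxx.
    move=> s u; rewrite !inE => /andP[s0 sK] u0 us; rewrite u0 /=.
    apply: (Kdown _ _ sK); last exact: imsetS.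
    by rewrite imset_eq0.
  apply/forall_inP=> s sK; rewrite inE.
  have s0 : s != set0 by apply: contraNneq K0 => <-.
  have -> : p @: (p @^-1: s) = s.
    apply/setP=> v; apply/imsetP/idP => [[z]|vs]; first by rewrite inE => h ->.
    by have [z zv] := psurj v; exists z; rewrite // inE zv.
  rewrite sK andbT; have /set0Pn[v vs] := s0.
  by have [z zv] := psurj v; apply/set0Pn; exists z; rewrite inE zv.
move=> [t0 tK] L /andP[/is_complexP[L0 Ldown] /forall_inP LK].
apply: (Ldown _ _ (LK _ tK) t0).
by apply/subsetP=> z zt; rewrite inE imset_f.
Qed.

Lemma pullback_complex (V Z : finType) (p : Z -> V) (K : {set {set V}}) :
  is_complex K -> (forall v, exists z, p z = v) -> is_complex (pullback p K).
Proof.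
move=> Kc ps; apply/is_complexP; split; first by rewrite pullbackP // eqxx.
move=> s t; rewrite !pullbackP // => /andP[s0 sK] t0 ts; rewrite t0 /=.
have [_ Kdown] := is_complexP _ Kc.
apply: (Kdown _ _ sK); last exact: imsetS.
by rewrite imset_eq0.
Qed.

Lemma pullback_comp (V Z Y : finType) (p : Z -> V) (q : Y -> Z)
    (K : {set {set V}}) :
  is_complex K -> (forall v, exists z, p z = v) -> (forall z, exists y, q y = z) ->
  pullback (p \o q) K = pullback q (pullback p K).
Proof.
move=> Kc ps qs; apply/setP=> t.
have pqs v : exists y, (p \o q) y = v.
  by have [z <-] := ps v; have [y <-] := qs z; exists y.
rewrite [RHS]pullbackP //; last exact: pullback_complex.
by rewrite !pullbackP // imset_eq0 imset_comp; case: (t != set0).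
Qed.

Lemma eq_pullback (V Z : finType) (p q : Z -> V) (K : {set {set V}}) :
  p =1 q -> pullback p K = pullback q K.
Proof. by move=> /funext ->. Qed.

Section Filtrations.
Variable R : realType.

(* [fil_cx] is the ambient complex K_V and [fil_map q] the subcomplex F(q).   *)
Record filtration := Filtration {
  fil_idx : grid R;
  fil_vert : finType;
  fil_cx : {set {set fil_vert}};
  fil_map :> fil_idx -> {set {set fil_vert}};
  fil_cx_complex : is_complex fil_cx;
  fil_cx_vert : forall v : fil_vert, [set v] \in fil_cx;
  fil_complex : forall q, is_complex (fil_map q);
  fil_sub : forall q, fil_map q \subset fil_cx;
  fil_mono : forall q1 q2, q1 <= q2 -> fil_map q1 \subset fil_map q2;
  fil_max : forall q, (forall q', q' <= q) -> fil_map q = fil_cx }.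

Record fil_hom (F G : filtration) := FilHom {
  fil_gal : galois (fil_idx F) (fil_idx G);
  fil_span : finType;
  fil_pl : fil_span -> fil_vert F;
  fil_pr : fil_span -> fil_vert G;
  fil_pl_surj : forall v, exists z, fil_pl z = v;
  fil_pr_surj : forall w, exists z, fil_pr z = w;
  fil_homP : forall r : fil_idx G,
    pullback fil_pr (G r) = pullback fil_pl (F (gal_r fil_gal r)) }.

Definition fil_heq (F G : filtration) (m n : fil_hom F G) : Prop :=
  gal_eq (fil_gal m) (fil_gal n) /\
  exists2 b : fil_span m -> fil_span n, bijective b &
    (forall z, fil_pl (b z) = fil_pl z) /\ (forall z, fil_pr (b z) = fil_pr z).

Definition fil_id (F : filtration) : fil_hom F F :=
  @FilHom F F (gal_id (fil_idx F)) (fil_vert F) id id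
    (fun v => ex_intro _ v erefl) (fun v => ex_intro _ v erefl)
    (fun r => erefl).

Section Composition.
Variables (F G H : filtration) (m : fil_hom F G) (n : fil_hom G H).

Definition fiber_prod : finType :=
  {x : fil_span m * fil_span n | fil_pr x.1 == fil_pl x.2}.

Definition fiber_pr1 (x : fiber_prod) : fil_span m := (val x).1.
Definition fiber_pr2 (x : fiber_prod) : fil_span n := (val x).2.

Definition fiber_pair z z' (h : fil_pr z = fil_pl z') : fiber_prod :=
  exist _ (z, z') (introT eqP h).

Lemma fiber_prodP (x : fiber_prod) : fil_pr (fiber_pr1 x) = fil_pl (fiber_pr2 x).
Proof. exact/eqP/(valP x). Qed.

Lemma fiber_prod_inj (x y : fiber_prod) :
  fiber_pr1 x = fiber_pr1 y -> fiber_pr2 x = fiber_pr2 y -> x = y.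
Proof.
move=> h1 h2; apply: val_inj; rewrite [LHS]surjective_pairing [RHS]surjective_pairing.
by congr pair.
Qed.

Lemma fiber_pr1_surj z : exists x, fiber_pr1 x = z.
Proof.
have [y e] := fil_pl_surj n (fil_pr z).
by exists (fiber_pair (esym e)).
Qed.

Lemma fiber_pr2_surj z : exists x, fiber_pr2 x = z.
Proof.
have [y e] := fil_pr_surj m (fil_pl z).
by exists (fiber_pair e).
Qed.

Lemma fil_comp_pl_surj v : exists x : fiber_prod, fil_pl (fiber_pr1 x) = v.
Proof.
have [z <-] := fil_pl_surj m v; have [x <-] := fiber_pr1_surj z.
by exists x.
Qed.

Lemma fil_comp_pr_surj v : exists x : fiber_prod, fil_pr (fiber_pr2 x) = v.
Proof.
have [z <-] := fil_pr_surj n v; have [x <-] := fiber_pr2_surj z.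
by exists x.
Qed.

Lemma fil_comp_subproof (r : fil_idx H) :
  pullback (fun x : fiber_prod => fil_pr (fiber_pr2 x)) (H r) =
  pullback (fun x : fiber_prod => fil_pl (fiber_pr1 x))
    (F (gal_r (gal_comp (fil_gal m) (fil_gal n)) r)).
Proof.
have step (X Y Z : finType) (p : Y -> X) (q : Z -> Y) (K : {set {set X}}) :=
  @pullback_comp X Y Z p q K.
rewrite [LHS](step _ _ _ (@fil_pr _ _ n) fiber_pr2) ?fil_complex //;
  [|exact: fil_pr_surj|exact: fiber_pr2_surj].
rewrite [RHS](step _ _ _ (@fil_pl _ _ m) fiber_pr1) ?fil_complex //;
  [|exact: fil_pl_surj|exact: fiber_pr1_surj].
rewrite fil_homP -(fil_homP m) -!pullback_comp ?fil_complex //;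
  try by [exact: fil_pl_surj|exact: fil_pr_surj|exact: fiber_pr1_surj
         |exact: fiber_pr2_surj].
by apply: eq_pullback => x; rewrite /= -(eqP (valP x)).
Qed.

Definition fil_comp : fil_hom F H :=
  @FilHom F H (gal_comp (fil_gal m) (fil_gal n)) fiber_prod
    (fun x => fil_pl (fiber_pr1 x)) (fun x => fil_pr (fiber_pr2 x))
    fil_comp_pl_surj fil_comp_pr_surj fil_comp_subproof.

End Composition.

Lemma fil_heq_refl F G (m : fil_hom F G) : fil_heq m m.
Proof. by split=> //; exists id => //; exists id. Qed.

Lemma fil_heq_sym F G (m n : fil_hom F G) : fil_heq m n -> fil_heq n m.
Proof.
move=> [[h1 h2] [b [b' bK b'K] [bl br]]]; split.
  by split=> x; rewrite ?h1 ?h2.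
exists b'; first by exists b.
by split=> z; rewrite -?bl -?br b'K.
Qed.

Lemma fil_heq_trans F G (m n p : fil_hom F G) :
  fil_heq m n -> fil_heq n p -> fil_heq m p.
Proof.
move=> [[h1 h2] [b bb [bl br]]] [[h3 h4] [c cb [cl cr]]]; split.
  by split=> x; rewrite ?h1 ?h2 ?h3 ?h4.
exists (c \o b); first exact: bij_comp.
by split=> z; rewrite /= ?cl ?cr.
Qed.

Lemma fil_comp_heq F G H (m m' : fil_hom F G) (n n' : fil_hom G H) :
  fil_heq m m' -> fil_heq n n' -> fil_heq (fil_comp m n) (fil_comp m' n').
Proof.
move=> [[h1 h2] [b [b' bK b'K] [bl br]]] [[h3 h4] [c [c' cK c'K] [cl cr]]].
split; first by split=> x /=; rewrite ?h1 ?h2 ?h3 ?h4.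
have hd (x : fiber_prod m n) :
    fil_pr (b (fiber_pr1 x)) = fil_pl (c (fiber_pr2 x)).
  by rewrite br cl fiber_prodP.
have hd' (x : fiber_prod m' n') :
    fil_pr (b' (fiber_pr1 x)) = fil_pl (c' (fiber_pr2 x)).
  by rewrite -br -cl b'K c'K fiber_prodP.
exists (fun x => fiber_pair (hd x)).
  exists (fun x => fiber_pair (hd' x)) => x; apply: fiber_prod_inj;
    by rewrite /fiber_pr1 /fiber_pr2 /= ?bK ?cK ?b'K ?c'K.
by split=> z /=; rewrite ?bl ?cr.
Qed.

Lemma fil_comp_idl F G (m : fil_hom F G) : fil_heq (fil_comp (fil_id F) m) m.
Proof.
split=> //; exists (@fiber_pr2 _ _ _ (fil_id F) m).
  have hd (z : fil_span m) : @fil_pr _ _ (fil_id F) (fil_pl z) = fil_pl z by [].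
  exists (fun z => fiber_pair (hd z)) => // x.
  by apply: fiber_prod_inj => //; exact: esym (fiber_prodP x).
by split=> z //=; rewrite -fiber_prodP.
Qed.

Lemma fil_comp_idr F G (m : fil_hom F G) : fil_heq (fil_comp m (fil_id G)) m.
Proof.
split=> //; exists (@fiber_pr1 _ _ _ m (fil_id G)).
  have hd (z : fil_span m) : fil_pr z = @fil_pl _ _ (fil_id G) (fil_pr z) by [].
  exists (fun z => fiber_pair (hd z)) => // x.
  by apply: fiber_prod_inj => //; exact: (fiber_prodP x).
by split=> z //=; rewrite fiber_prodP.
Qed.

Lemma fil_compA F G H E (m : fil_hom F G) (n : fil_hom G H) (p : fil_hom H E) :
  fil_heq (fil_comp m (fil_comp n p)) (fil_comp (fil_comp m n) p).
Proof.
split=> //.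
pose T := fiber_prod m (fil_comp n p); pose T' := fiber_prod (fil_comp m n) p.
have h1 (x : T) : fil_pr (fiber_pr1 x) = fil_pl (fiber_pr1 (fiber_pr2 x)).
  exact: (fiber_prodP x).
have h2 (x : T) :
    @fil_pr _ _ (fil_comp m n) (fiber_pair (h1 x)) = fil_pl (fiber_pr2 (fiber_pr2 x)).
  exact: (fiber_prodP (fiber_pr2 x)).
have k1 (x : T') : fil_pr (fiber_pr2 (fiber_pr1 x)) = fil_pl (fiber_pr2 x).
  exact: (fiber_prodP x).
have k2 (x : T') :
    fil_pr (fiber_pr1 (fiber_pr1 x)) = @fil_pl _ _ (fil_comp n p) (fiber_pair (k1 x)).
  exact: (fiber_prodP (fiber_pr1 x)).
exists (fun x : T => fiber_pair (h2 x) : T'); last by [].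
exists (fun x : T' => fiber_pair (k2 x) : T) => x;
  by apply: fiber_prod_inj => //; apply: fiber_prod_inj.
Qed.

Definition Fil : category :=
  @Category filtration fil_hom fil_heq fil_id fil_comp fil_heq_refl fil_heq_sym
    fil_heq_trans fil_comp_heq fil_comp_idl fil_comp_idr fil_compA.

Definition fil_cost (F G : Fil) (m : cat_hom F G) : R :=
  \big[Num.max/0]_(q1 : fil_idx F) \big[Num.max/0]_(q2 : fil_idx F)
    `| `|val q1 - val q2| -
       `|val (fil_gal (m : fil_hom F G) q1) - val (fil_gal (m : fil_hom F G) q2)| |.

End Filtrations.

Section Chains.
Variables (k : fieldType) (V : finType).

(* Chains are functions on all subsets of V, so that the chain spaces of all  *)
(* subcomplexes of K_V are subspaces of one vector space.                     *)
Definition chain : vectType k := {ffun {set V} -> k^o}.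

Definition simplex (s : {set V}) : chain := [ffun t => (t == s)%:R].

(* Simplices are oriented by the enumeration order of V.                      *)
Definition face_sign (s : {set V}) (v : V) : k :=
  (-1) ^+ #|[set w in s | (enum_rank w < enum_rank v)%N]|.

(* The boundary of a vertex is 0, not the empty simplex.                      *)
Definition bd_simplex (s : {set V}) : chain :=
  \sum_(v in s | (1 < #|s|)%N) face_sign s v *: simplex (s :\ v).

Definition bd_fun (c : chain) : chain :=
  \sum_(s : {set V}) c s *: bd_simplex s.

Lemma bd_fun_is_linear : linear bd_fun.
Proof.
move=> a c1 c2; rewrite /bd_fun scaler_sumr -big_split /=.
by apply: eq_bigr => s _; rewrite !ffunE scalerDl scalerA.
Qed.

HB.instance Definition _ := GRing.isLinear.Build k chain chain _ bd_fun
  bd_fun_is_linear.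

Definition bd : 'End(chain) := linfun bd_fun.

Definition chains (d : nat) (K : {set {set V}}) : {vspace chain} :=
  <<[seq simplex s | s : {set V} <- enum K & #|s| == d.+1]>>%VS.

Definition cycles d K : {vspace chain} := (chains d K :&: lker bd)%VS.
Definition boundaries d K : {vspace chain} := (bd @: chains d.+1 K)%VS.

Lemma chainsS d (K L : {set {set V}}) : K \subset L -> (chains d K <= chains d L)%VS.
Proof.
move=> /subsetP KL; apply: sub_span => c /mapP[s].
rewrite mem_filter mem_enum => /andP[sd sK] ->.
by apply: map_f; rewrite mem_filter sd mem_enum KL.
Qed.

Lemma cyclesS d (K L : {set {set V}}) : K \subset L -> (cycles d K <= cycles d L)%VS.
Proof. by move=> KL; apply: capvS => //; exact: chainsS. Qed.

Lemma boundariesS d (K L : {set {set V}}) :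
  K \subset L -> (boundaries d K <= boundaries d L)%VS.
Proof. by move=> KL; apply: limgS; exact: chainsS. Qed.

End Chains.

Section Nonnegativity.
Variables (k : fieldType) (W : vectType k) (R : realType) (Q : {fset R}).
Variables A B : Q -> {vspace W}.
Hypothesis AS : forall q r, q <= r -> (A q <= A r)%VS.
Hypothesis BS : forall q r, q <= r -> (B q <= B r)%VS.

Let h (I : interv Q) : int := (\dim (A (lo I) :&: B (hi I))%VS)%:Z.

Lemma predecessor (q : Q) :
  (forall x, (x < q) = false) \/ exists p, forall x, (x < q) = (x <= p).
Proof.
have [[x0 x0q]|no] := pselect (exists x0, x0 < q); last first.
  by left=> x; apply/negP=> xq; apply: no; exists x.
right; case: (@arg_maxP _ _ Q x0 (fun x => x < q) id x0q) => p pq pmax.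
exists p => x; apply/idP/idP; first exact: pmax.
by move=> xp; apply: le_lt_trans xp pq.
Qed.

Lemma mobius_dim_ge0 (I : interv Q) : 0 <= mobius_inv h I.
Proof.
set mu := mobius_inv h.
have hE J : h J = \sum_(y | (y <= J)%O) mu y by exact: mobius_invP.
have leE (J K : interv Q) : (J <= K)%O = (lo J <= lo K) && (hi J <= hi K) by [].
have eqE (J K : interv Q) : (J == K) = (lo J == lo K) && (hi J == hi K).
  by rewrite -val_eqE.
have -> : mu I = h I - \sum_(y | (y <= I)%O && (y != I)) mu y.
  by rewrite [h I]hE (bigD1 I) //= addrK.
rewrite subr_ge0.
have IE := interv_le I.
have [eqI|neqI] := eqVneq (lo I) (hi I).
  have lowE J : (J <= I)%O && (J != I) = (J <= I)%O && (lo J < lo I).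
    have [JI|//] := boolP (J <= I)%O; rewrite eqE /= negb_and.
    have /andP[l1 l2] : (lo J <= lo I) && (hi J <= hi I) by rewrite -leE.
    rewrite lt_neqAle l1 andbT; have [e|//] /= := eqVneq (lo J) (lo I).
    apply/negbTE/negPn/eqP/le_anti; rewrite l2 -eqI -e; exact: interv_le J.
  rewrite (eq_bigl _ _ lowE).
  have [noq|[p pE]] := predecessor (lo I).
    by rewrite big1 // => J; rewrite noq andbF.
  have pI : p <= hi I by rewrite -eqI ltW // pE.
  rewrite (eq_bigl (fun J => J <= Interv (interv_val := (p, hi I)) pI)%O).
    rewrite -hE lez_nat dimvS // capvS //; apply: AS.
    by rewrite /lo /= ltW // pE.
  move=> J; rewrite !leE pE {2 4}/lo {2}/hi /= [in RHS]andbC -andbA andbC -andbA.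
  congr (_ && _); rewrite andb_idr // => Jp.
  by apply: ltW; rewrite pE.
have ltI : lo I < hi I by rewrite lt_neqAle neqI.
have [noq|[b bE]] := predecessor (hi I); first by rewrite noq in ltI.
have Ib : lo I <= b by rewrite -bE.
have bI : b < hi I by rewrite bE.
set Ib' := Interv (interv_val := (lo I, b)) Ib.
rewrite (bigID (fun J => hi J < hi I)) /=.
have e1 J : ((J <= I)%O && (J != I)) && (hi J < hi I) = (J <= Ib')%O.
  rewrite !leE eqE -[lo Ib']/(lo I) -[hi Ib']/b -bE.
  have [l|] := boolP (hi J < hi I); last by rewrite !andbF.
  by rewrite (ltW l) (lt_eqF l) andbF /= !andbT.
have e2 J : ((J <= I)%O && (J != I)) && ~~ (hi J < hi I) =
            (hi J == hi I) && (lo J < lo I).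
  rewrite leE eqE lt_neqAle [lo J < _]lt_neqAle.
  have [->|] := eqVneq (hi J) (hi I); first by rewrite lexx /= !andbT andbC.
  by case: (hi J <= hi I); rewrite ?andbF.
rewrite (eq_bigl _ _ e1) (eq_bigl _ _ e2) -hE.
have [noq|[a aE]] := predecessor (lo I).
  rewrite [X in _ + X]big1 ?addr0 => [|J]; last by rewrite noq andbF.
  by rewrite lez_nat dimvS // capvS // BS // ltW.
have aI : a < lo I by rewrite aE.
have ab : a <= b := ltW (lt_le_trans aI Ib).
have ahi : a <= hi I := le_trans (ltW aI) IE.
set Ia := Interv (interv_val := (a, hi I)) ahi.
set Iab := Interv (interv_val := (a, b)) ab.
have -> : \sum_(J : interv Q | (hi J == hi I) && (lo J < lo I)) mu J = h Ia - h Iab.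
  rewrite (hE Ia) (hE Iab) [X in _ = X - _](bigID (fun J => hi J < hi I)) /=.
  rewrite [X in _ = X + _ - _](eq_bigl (fun J => J <= Iab)%O); last first.
    move=> J; rewrite !leE -[lo Ia]/a -[hi Ia]/(hi I) -[lo Iab]/a -[hi Iab]/b -bE.
    by have [l|] := boolP (hi J < hi I); rewrite ?(ltW l) ?andbT ?andbF.
  rewrite addrAC subrr add0r; apply: eq_bigl => J.
  rewrite !leE -[lo Ia]/a -[hi Ia]/(hi I) aE.
  rewrite [hi J < _]lt_neqAle andbC.
  by have [->|] := eqVneq (hi J) (hi I); rewrite ?lexx ?andbT //=;
     case: (hi J <= hi I); rewrite ?andbF.
rewrite addrA lerBlDr -!PoszD lez_nat.
rewrite -dimv_sum_cap leq_add // dimvS //.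
  rewrite subv_add; apply/andP; split; apply: capvS; rewrite ?subvv ?AS ?BS //.
  - exact: ltW.
  - exact: ltW.
rewrite subv_cap; apply/andP; split.
  by apply: subv_trans (capvSr _ _) _; exact: capvSl.
by apply: subv_trans (capvSl _ _) _; exact: capvSr.
Qed.

End Nonnegativity.

Section PersistenceDiagram.
Variables (k : fieldType) (R : realType) (d : nat) (F : filtration R).

Definition ZB (I : interv (fil_idx F)) : nat :=
  \dim (cycles k d (F (lo I)) :&: boundaries k d (F (hi I)))%VS.

Definition PD_int (I : interv (fil_idx F)) : int :=
  mobius_inv (fun J => (ZB J)%:Z) I.

Lemma PD_int_ge0 I : 0 <= PD_int I.
Proof.
apply: (mobius_dim_ge0 (A := fun q => cycles k d (F q))
                       (B := fun q => boundaries k d (F q))) => q r qr.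
  exact/cyclesS/fil_mono.
exact/boundariesS/fil_mono.
Qed.

(* The absolute value only changes the type, by [PD_int_ge0].                 *)
Definition PD : diagram R := @Diagram R (fil_idx F) (fun I => `|PD_int I|%N).

Lemma PDE (I : interv (fil_idx F)) : (PD I)%:Z = PD_int I.
Proof. exact/gez0_abs/PD_int_ge0. Qed.

Lemma ZBE (I : interv (fil_idx F)) :
  (ZB I)%:Z = \sum_(J | (J <= I)%O) (PD J)%:Z.
Proof.
rewrite [LHS](mobius_invP (fun J => (ZB J)%:Z)).
by apply: eq_bigr => J _; rewrite PDE.
Qed.

End PersistenceDiagram.

(* Main.v *)
Require Import Defs.
From HB Require Import structures.
From mathcomp Require Import all_boot all_order all_algebra finmap.
From mathcomp Require Import reals constructive_ereal ereal.
From mathcomp Require Import fintype finset.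

(** The proposition reduces to one fact about homology: pulling a filtration
    back along a surjection p : Z -> V of vertex sets changes dim Z_d and ZB_d,
    but not the rank of the map H_d(K) -> H_d(L) induced by an inclusion K <= L
    of levels.  This rank is dim Z_d(K) - dim (Z_d(K) :&: B_d(L)), the number
    [pbetti] below, so pulling back changes ZB_d([q1, q2]) by an amount that
    depends on q1 only.

    Consequently a morphism of filtrations with Galois connection (f, g) gives
    ZB^G([r1, r2]) = ZB^F([g r1, g r2]) + c(r1) for some function c of r1.
    Because f [q1, q2] <= [r1, r2] iff [q1, q2] <= [g r1, g r2], the function
    K |-> ZB^F(g K) is the sum over the J <= K of the push-forward of PD^F; and
    c(r1) is the sum over the J <= [r1, r2] of a function supported on the
    diagonal, since [p, p] <= [r1, r2] iff p <= r1.  Uniqueness of Moebius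
    inverses then makes PD^G equal to the push-forward of PD^F off the diagonal
    ([mobius_inv_gal_bar], [PD_pushforward]).  As the morphism of diagrams is
    the Galois connection itself, the functor laws are immediate; it costs at
    most as much as the morphism of filtrations because the maximum norm on
    intervals is 1-Lipschitz in the two coordinate distances ([PD_cost]), and
    applying a functor that does not increase costs to a zigzag yields the
    inequality of edit distances ([edit_dist_map]).

    The invariance of [pbetti] ([pbetti_pullback]) is proved on the vertex set
    V + Z, with q : V + Z -> V equal to the identity on V and to p on Z.  In a
    pullback along q, two vertices with the same image are interchangeable: a
    simplex containing one of them stays a simplex when the other is added.
    Sending a vertex z to such a z' is a retraction onto the chains avoiding z,
    chain homotopic to the identity inside every level, so z can be deleted
    without changing [pbetti] ([pbetti_delete_vertex]).  Deleting all of V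
    leaves the pullback along p; deleting all of Z leaves the original complex.
    The chain homotopy is written with the operators of exterior multiplication
    and contraction, which turn all sign computations into the
    anticommutation relations. *)

Set Implicit Arguments.
Unset Strict Implicit.
Unset Printing Implicit Defensive.

Import Order.TTheory GRing.Theory Num.Theory.

Local Open Scope ring_scope.

(** * Exterior multiplication and contraction on chains *)

Section ChainOperators.
Variables (k : fieldType) (V : finType).
Implicit Types (c : chain k V) (s t : {set V}) (v w z : V).

Local Notation sgn := (face_sign k).

(** The position of [w] in the vertex order shifts by one exactly when the new
    vertex precedes [w]. *)
Lemma face_signU s v w : v \notin s ->
  sgn (v |: s) w = (-1) ^+ (enum_rank v < enum_rank w)%N * sgn s w.
Proof.
move=> vs; rewrite /face_sign.
have [vw|vw] := boolP (enum_rank v < enum_rank w)%N; last first.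
  rewrite mul1r; congr (_ ^+ _); apply: eq_card => x; rewrite !inE.
  by have [->|//] := eqVneq x v; rewrite (negbTE vw) !andbF.
rewrite -exprD; congr (_ ^+ _).
have -> : [set x in v |: s | (enum_rank x < enum_rank w)%N]
   = v |: [set x in s | (enum_rank x < enum_rank w)%N].
  by apply/setP => x; rewrite !inE; have [->|//] := eqVneq x v; rewrite vw.
by rewrite cardsU1 inE (negbTE vs).
Qed.

Lemma face_sign_self s v : sgn (v |: s) v = sgn s v.
Proof.
have [vs|vs] := boolP (v \in s); last by rewrite face_signU // ltnn mul1r.
by have /setUidPr -> : [set v] \subset s by rewrite sub1set.
Qed.

Lemma face_sign_sqr s v : sgn s v * sgn s v = 1.
Proof. by rewrite -expr2 sqrr_sign. Qed.

(** Exactly one of two distinct vertices precedes the other, so adding them to a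
    simplex in the two possible orders produces opposite signs.  Every
    anticommutation relation below comes from this one. *)
Lemma face_sign_swap s v w : v != w -> v \notin s -> w \notin s ->
  sgn s v * sgn (v |: s) w = - (sgn s w * sgn (w |: s) v).
Proof.
move=> vw vs ws; rewrite !face_signU //.
have : enum_rank v != enum_rank w by rewrite (inj_eq enum_rank_inj).
rewrite -val_eqE neq_ltn => /orP[] h; rewrite h ltnNge (ltnW h) /=.
  by rewrite mulN1r mul1r mulrN mulrC.
by rewrite mulN1r mul1r mulrN opprK mulrC.
Qed.

(** Reading a simplex as the exterior product of its vertices in increasing
    order, this is left multiplication by [v]; the formula gives the coefficient
    of the result at [t]. *)
Definition wedge v c : chain k V :=
  [ffun t : {set V} => if v \in t then sgn t v * c (t :\ v) else 0].

(** The interior product with the functional dual to [v], which deletes [v] with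
    the sign of the corresponding face. *)
Definition contract v c : chain k V :=
  [ffun t : {set V} => if v \in t then 0 else sgn t v * c (v |: t)].

Lemma wedge_is_linear v : linear (wedge v).
Proof.
move=> a c1 c2; apply/ffunP => t; rewrite !ffunE; case: ifP => _.
  by rewrite mulrDr scalerAr.
by rewrite scaler0 addr0.
Qed.

HB.instance Definition _ v :=
  GRing.isLinear.Build k (chain k V) (chain k V) _ (wedge v) (wedge_is_linear v).

Lemma contract_is_linear v : linear (contract v).
Proof.
move=> a c1 c2; apply/ffunP => t; rewrite !ffunE; case: ifP => _.
  by rewrite scaler0 addr0.
by rewrite mulrDr scalerAr.
Qed.

HB.instance Definition _ v :=
  GRing.isLinear.Build k (chain k V) (chain k V) _ (contract v)
    (contract_is_linear v).

Lemma contractC v w c : contract v (contract w c) = - contract w (contract v c).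
Proof.
apply/ffunP => t; rewrite !ffunE !in_setU1.
have [vt|vt] := boolP (v \in t); first by rewrite orbT mulr0 if_same oppr0.
have [wt|wt] := boolP (w \in t); first by rewrite orbT mulr0 oppr0.
have [->|vw] := eqVneq w v; first by rewrite mulr0 oppr0.
rewrite /= !mulrA face_sign_swap 1?eq_sym // mulNr.
by rewrite setUCA.
Qed.

Lemma wedge_contractC v w c : v != w ->
  wedge v (contract w c) = - contract w (wedge v c).
Proof.
move=> vw; apply/ffunP => t; rewrite !ffunE !inE (negbTE vw) /=.
rewrite [w == v]eq_sym (negbTE vw) /=.
have [wt|wt] := boolP (w \in t); first by rewrite mulr0 if_same oppr0.
have [vt|vt] := boolP (v \in t); last by rewrite mulr0 oppr0.
have -> : (w |: t) :\ v = w |: (t :\ v).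
  by apply/setP => x; rewrite !inE; have [->|] := eqVneq x v; rewrite ?(negbTE vw).
rewrite !mulrA -mulNr; congr (_ * _).
set u := t :\ v; have wu : w \notin u by rewrite !inE (negbTE wt) andbF.
have vu : v \notin u by rewrite !inE eqxx.
rewrite -(setD1K vt) -/u setUCA !face_sign_self.
have h := face_sign_swap vw vu wu.
have -> : sgn u v * sgn u w = sgn u v * sgn (v |: u) w * (sgn u w * sgn (v |: u) w).
  by rewrite mulrACA face_sign_sqr mulr1.
by rewrite h mulNr mulrACA face_sign_sqr mul1r [in RHS]mulrC.
Qed.

Lemma wedge_contractD v c : wedge v (contract v c) + contract v (wedge v c) = c.
Proof.
apply/ffunP => t; rewrite !ffunE !inE eqxx /=.
case: ifPn => vt.
  by rewrite addr0 -{1}(setD1K vt) face_sign_self mulrA face_sign_sqr mul1r setD1K.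
by rewrite add0r face_sign_self mulrA face_sign_sqr mul1r setU1K.
Qed.

End ChainOperators.
(** * The collapse of one vertex onto another *)

Section VertexCollapse.
Variables (k : fieldType) (V : finType).
Implicit Types (c : chain k V) (s t : {set V}) (v w z : V) (K L : {set {set V}}).

Local Notation sgn := (face_sign k).

(** The augmented boundary: it agrees with the simplicial boundary except that
    the boundary of a vertex is the empty simplex.  It interacts with [wedge] and
    [contract] without exceptional cases. *)
Definition aug_bd c : chain k V := \sum_v contract v c.

Lemma aug_bd_is_linear : linear aug_bd.
Proof.
move=> a c1 c2; rewrite /aug_bd scaler_sumr -big_split /=.
by apply: eq_bigr => v _; rewrite linearP.
Qed.

HB.instance Definition _ :=
  GRing.isLinear.Build k (chain k V) (chain k V) _ aug_bd aug_bd_is_linear.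

Definition nonempty_part c : chain k V :=
  [ffun t : {set V} => if t == set0 then 0 else c t].

Lemma nonempty_part_is_linear : linear nonempty_part.
Proof.
move=> a c1 c2; apply/ffunP => t; rewrite !ffunE; case: ifP => _ //.
by rewrite scaler0 addr0.
Qed.

HB.instance Definition _ :=
  GRing.isLinear.Build k (chain k V) (chain k V) _ nonempty_part
    nonempty_part_is_linear.

(** The boundary that kills vertices is the augmented boundary followed by
    forgetting the empty simplex. *)
Lemma bd_funE c : bd_fun c = nonempty_part (aug_bd c).
Proof.
apply/ffunP => t; rewrite /bd_fun /aug_bd sum_ffunE ffunE.
under eq_bigr do rewrite ffunE /bd_simplex sum_ffunE big_mkcond /= -[_ *: _]/(_ * _) mulr_sumr.
rewrite exchange_big /=.
have [->|t0] := eqVneq t set0.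
  rewrite big1 // => v _; rewrite big1 // => s _; case: ifP; last by rewrite mulr0.
  move=> /andP[vs cs]; rewrite !ffunE; case: eqP => [e|_]; last by rewrite scaler0 mulr0.
  by move: cs; rewrite (cardsD1 v) vs -e cards0.
rewrite sum_ffunE; apply: eq_bigr => v _; rewrite ffunE.
have [vt|vt] := boolP (v \in t).
  rewrite big1 // => s _; case: ifP; last by rewrite mulr0.
  move=> _; rewrite !ffunE; case: eqP => [e|_]; last by rewrite scaler0 mulr0.
  by move: vt; rewrite e !inE eqxx.
(* The only simplex whose face opposite to [v] is [t] is [v |: t]. *)
rewrite (bigD1 (v |: t)) //= big1 ?addr0 => [|s sN].
  rewrite setU11 cardsU1 vt ltnS card_gt0 t0 /= !ffunE setU1K // eqxx.
  by rewrite face_sign_self mulrC; congr (_ * _); exact: mulr1.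
case: ifP; last by rewrite mulr0.
move=> /andP[vs _]; rewrite !ffunE; case: eqP => [e|_]; last by rewrite scaler0 mulr0.
by move: sN; rewrite e setD1K // eqxx.
Qed.

(** The cone formula: [w] anticommutes with the contraction of every other
    vertex, and the contraction of [w] itself contributes the identity. *)
Lemma aug_bd_wedge w c : aug_bd (wedge w c) = c - wedge w (aug_bd c).
Proof.
rewrite /aug_bd linear_sum /= (bigD1 w) //= [in RHS](bigD1 w) //=.
have -> : contract w (wedge w c) = c - wedge w (contract w c).
  by rewrite -{2}(wedge_contractD w c) addrAC subrr add0r.
rewrite opprD addrA -sumrN; congr (_ + _).
by apply: eq_bigr => v vw; rewrite wedge_contractC 1?eq_sym // opprK.
Qed.

Lemma aug_bd_contract w c : aug_bd (contract w c) = - contract w (aug_bd c).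
Proof.
by rewrite /aug_bd linear_sum -sumrN; apply: eq_bigr => v _; rewrite contractC.
Qed.

Lemma memv_chains d K c :
  reflect (forall t, c t != 0 -> (t \in K) && (#|t| == d.+1)) (c \in chains k d K).
Proof.
apply: (iffP idP) => [cK t|h]; last first.
  have -> : c = \sum_t c t *: simplex k t.
    apply/ffunP => t; rewrite sum_ffunE (bigD1 t) //= big1 ?addr0.
      by rewrite !ffunE eqxx; exact/esym/mulr1.
    by move=> s st; rewrite !ffunE eq_sym (negbTE st) scaler0.
  apply: rpred_sum => t _; have [->|ct] := eqVneq (c t) 0.
    by rewrite scale0r mem0v.
  apply/rpredZ/memv_span/map_f; rewrite mem_filter mem_enum andbC.
  exact: h.
apply: contraR => tK.
have /coord_span -> : c \in <<in_tuple [seq simplex k s | s <- enum K & #|s| == d.+1]>>%VS.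
  by [].
rewrite sum_ffunE.
apply/eqP; rewrite big1 // => i _; rewrite ffunE.
have /mapP[s] := mem_nth 0 (ltn_ord i).
rewrite mem_filter mem_enum => sK ->; rewrite ffunE.
case: eqP => [e|_]; last by rewrite scaler0.
by move: tK; rewrite e andbC sK.
Qed.

(** Removing and restoring [v] is the projection onto the simplices that contain
    it. *)
Lemma wedge_contractE v c (t : {set V}) :
  wedge v (contract v c) t = if v \in t then c t else 0.
Proof.
rewrite !ffunE; case: ifP => // vt; rewrite !inE eqxx /=.
by rewrite -{1}(setD1K vt) face_sign_self mulrA face_sign_sqr mul1r setD1K.
Qed.

Variables (z z' : V).

(** The chain map induced by sending [z] to [z'] and fixing the other vertices:
    the part of [c] on simplices containing [z] is removed and put back with [z]
    replaced by [z']; simplices containing both become degenerate and vanish. *)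
Definition collapse c : chain k V :=
  c - wedge z (contract z c) + wedge z' (contract z c).

Lemma collapseE c (t : {set V}) : collapse c t =
  c t - (if z \in t then c t else 0) + wedge z' (contract z c) t.
Proof.
rewrite -wedge_contractE /collapse; move: (wedge z _) (wedge z' _) => a b.
by rewrite !ffunE.
Qed.

Lemma collapse_is_linear : linear collapse.
Proof.
move=> a c1 c2; rewrite /collapse !linearP /=.
by rewrite [X in X + _]addrACA -scalerDr addrACA -scalerDr.
Qed.

HB.instance Definition _ :=
  GRing.isLinear.Build k (chain k V) (chain k V) _ collapse collapse_is_linear.

(** The homotopy adds [z'] to the simplices containing [z], which fills in the
    prism between a simplex and its collapse. *)
Definition prism c : chain k V := wedge z' (wedge z (contract z c)).

Lemma aug_bd_collapse c : aug_bd (collapse c) = collapse (aug_bd c).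
Proof.
rewrite /collapse linearD linearB /= !aug_bd_wedge !aug_bd_contract !linearN /=.
rewrite !opprK addrA; congr (_ + _).
by rewrite opprD -addrA; congr (_ + _); rewrite addrAC addNr add0r.
Qed.

Lemma aug_bd_prism c : aug_bd (prism c) + prism (aug_bd c) = c - collapse c.
Proof.
rewrite /prism /collapse aug_bd_wedge aug_bd_wedge aug_bd_contract linearN opprK.
rewrite linearD /= opprD addrA subrK.
by rewrite opprD opprB addrA [c + _]addrC subrK.
Qed.

(* Neither the collapse nor the prism moves coefficients between the empty
   simplex and the others, so the identities for the augmented boundary descend
   to the boundary. *)
Let setU1_eq0 v t : (v |: t == set0) = false.
Proof. by apply/negbTE/set0Pn; exists v; rewrite setU11. Qed.

Lemma collapse_nonempty c :
  collapse (nonempty_part c) = nonempty_part (collapse c).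
Proof.
apply/ffunP => t; rewrite !ffunE !inE !setU1_eq0.
by case: eqP => [->|]; rewrite ?inE ?subr0 ?addr0.
Qed.

Lemma prism_nonempty c : prism (nonempty_part c) = prism c.
Proof.
by apply/ffunP => t; rewrite !ffunE !inE setU1_eq0.
Qed.

Lemma nonempty_prism c : nonempty_part (prism c) = prism c.
Proof.
apply/ffunP => t; rewrite !ffunE; case: eqP => // ->.
by rewrite inE.
Qed.

Lemma bd_collapse c : bd k V (collapse c) = collapse (bd k V c).
Proof. by rewrite !lfunE /= !bd_funE aug_bd_collapse collapse_nonempty. Qed.

(** The chain homotopy between the identity and the collapse.  It passes from
    the augmented boundary to the boundary because the collapse preserves the
    coefficient of the empty simplex. *)
Lemma bd_prism c : c - collapse c = bd k V (prism c) + prism (bd k V c).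
Proof.
rewrite !lfunE /= !bd_funE prism_nonempty -[prism (aug_bd c)]nonempty_prism.
rewrite -linearD aug_bd_prism; apply/ffunP => t; rewrite [RHS]ffunE.
case: eqP => // ->.
by rewrite [LHS]ffunE [X in _ + X]ffunE collapseE [wedge z' _ _]ffunE !inE
  subr0 addr0 subrr.
Qed.

End VertexCollapse.
(** * Deleting dominated vertices preserves persistent Betti numbers *)

Section PersistentBetti.
Variables (k : fieldType) (d : nat).

(** Both sides are the dimension of a quotient, A / (A :&: B) and
    A' / (A' :&: B').  The retraction maps A onto A' and A :&: B onto A' :&: B',
    and these two maps have the same kernel since an element of A killed by [r]
    is the difference x - r x, hence in B. *)
Lemma subn_dim_retract (W : vectType k) (r : 'End(W)) (A B A' B' : {vspace W}) :
    (A' <= A)%VS -> (B' <= B)%VS -> (r @: A <= A')%VS -> (r @: B <= B')%VS ->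
    {in A', forall x, r x = x} -> {in A, forall x, x - r x \in B} ->
  (\dim A - \dim (A :&: B) = \dim A' - \dim (A' :&: B'))%N.
Proof.
move=> sA sB rA rB fixA homA.
have e1 : (r @: A)%VS = A'.
  apply/eqP; rewrite eqEsubv rA; apply/subvP => x xA'.
  by rewrite -(fixA x xA') memv_img // (subvP sA).
have e2 : (r @: (A :&: B))%VS = (A' :&: B')%VS.
  apply/eqP; rewrite eqEsubv; apply/andP; split; apply/subvP => x.
    move=> /memv_imgP[y]; rewrite memv_cap => /andP[yA yB] ->.
    by rewrite memv_cap (subvP rA) ?(subvP rB) ?memv_img.
  rewrite memv_cap => /andP[xA' xB']; rewrite -(fixA x xA').
  by rewrite memv_img // memv_cap (subvP sA) // (subvP sB).
have e3 : (A :&: B :&: lker r)%VS = (A :&: lker r)%VS.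
  rewrite -capvA [(B :&: _)%VS]capvC capvA; apply/capv_idPl/subvP => x.
  rewrite memv_cap memv_ker => /andP[xA /eqP rx].
  by have := homA x xA; rewrite rx subr0.
by rewrite -(limg_ker_dim r A) -(limg_ker_dim r (A :&: B)) e1 e2 e3 subnDl.
Qed.

(** For K contained in L this is the rank of the map H_d(K) -> H_d(L), a
    persistent Betti number. *)
Definition pbetti (V : finType) (K L : {set {set V}}) : nat :=
  (\dim (cycles k d K) - \dim (cycles k d K :&: boundaries k d L)%VS)%N.

Section Deletion.
Variable V : finType.
Implicit Types (K L : {set {set V}}) (S U : {set V}).

(** If [z'] differs from [z], the link of [z] is then a cone with apex [z'], which makes deleting [z] a
    homotopy equivalence. *)
Definition dominated_in K (z z' : V) := forall s, s \in K -> z \in s -> z' |: s \in K.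

Definition delete_vertex (z : V) K : {set {set V}} := [set s in K | z \notin s].

Definition restrict K U : {set {set V}} := [set s in K | s \subset U].

Lemma restrict_complex K U : is_complex K -> is_complex (restrict K U).
Proof.
move=> /is_complexP[K0 Kd]; apply/is_complexP; split.
  by rewrite inE (negbTE K0).
move=> s t; rewrite !inE => /andP[sK sU] t0 ts.
by rewrite (Kd s) // (subset_trans ts).
Qed.

(** A simplex [t] of the collapse that is not already in the chain arises from
    one with [z'] replaced by [z]; domination puts both vertices and [t] into one
    simplex of [K]. *)
Lemma collapse_chains n z z' K c : is_complex K -> z != z' -> dominated_in K z z' ->
  c \in chains k n K -> collapse z z' c \in chains k n (delete_vertex z K).
Proof.
move=> /is_complexP[_ Kd] zz' tw /memv_chains cK; apply/memv_chains => t.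
rewrite collapseE; have [zt|zt] := boolP (z \in t).
  rewrite subrr add0r !ffunE !inE zz' zt /=.
  by rewrite mulr0 if_same eqxx.
rewrite subr0 inE zt andbT.
have [ct0|/cK//] := eqVneq (c t) 0.
rewrite ct0 add0r !ffunE; case: ifP => [z't|]; last by rewrite eqxx.
rewrite !inE (negbTE zt) andbF !mulf_eq0 !negb_or => /and3P[_ _ /cK/andP[uK ucard]].
have t0 : t != set0 by apply/set0Pn; exists z'.
apply/andP; split.
  apply: (Kd _ _ (tw _ uK (setU11 _ _)) t0).
  by rewrite setUCA setD1K // subsetUr.
move: ucard; rewrite cardsU1 !inE (negbTE zt) andbF /= => /eqP <-.
by rewrite [X in X == _](cardsD1 z') z't.
Qed.

Lemma prism_chains n z z' K c : dominated_in K z z' ->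
  c \in chains k n K -> prism z z' c \in chains k n.+1 K.
Proof.
move=> tw /memv_chains cK; apply/memv_chains => t.
rewrite ffunE; case: ifP => [z't|]; last by rewrite eqxx.
rewrite wedge_contractE; case: ifP => [zt|]; last by rewrite mulr0 eqxx.
rewrite mulf_eq0 negb_or => /andP[_ /cK/andP[uK ucard]].
have zu : z \in t :\ z' by [].
by rewrite -(setD1K z't) tw //= cardsU1 in_setD1 eqxx (eqP ucard).
Qed.

Lemma collapse_id n z z' K c :
  c \in chains k n (delete_vertex z K) -> collapse z z' c = c.
Proof.
move=> /memv_chains cK.
rewrite /collapse; suff -> : contract z c = 0 by rewrite !linear0 !addr0.
apply/ffunP => t; rewrite !ffunE; case: ifP => // _.
have [->|/cK] := eqVneq (c (z |: t)) 0; first by rewrite mulr0.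
by rewrite !inE eqxx andbF.
Qed.

Lemma delete_vertex_sub z K : delete_vertex z K \subset K.
Proof. by apply/subsetP => s; rewrite inE => /andP[]. Qed.

Lemma pbetti_delete_vertex z z' K L : is_complex K -> is_complex L -> K \subset L ->
    z != z' -> dominated_in K z z' -> dominated_in L z z' ->
  pbetti K L = pbetti (delete_vertex z K) (delete_vertex z L).
Proof.
move=> Kc Lc KL zz' twK twL.
have rE c : linfun (collapse (k := k) z z') c = collapse z z' c by rewrite lfunE.
apply: (subn_dim_retract (r := linfun (collapse z z'))).
- exact/cyclesS/delete_vertex_sub.
- exact/boundariesS/delete_vertex_sub.
- apply/subvP => y /memv_imgP[c]; rewrite memv_cap memv_ker => /andP[cK /eqP c0] {y}->.
  by rewrite rE memv_cap collapse_chains // memv_ker bd_collapse c0 linear0 eqxx.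
- apply/subvP => _ /memv_imgP[_ /memv_imgP[c cL ->] ->].
  by rewrite rE -bd_collapse memv_img // collapse_chains.
- by move=> c; rewrite memv_cap => /andP[cK _]; rewrite rE; exact: collapse_id cK.
- move=> c; rewrite memv_cap memv_ker => /andP[cK /eqP c0]; rewrite rE.
  rewrite bd_prism c0 /prism !linear0 addr0 memv_img //.
  apply: prism_chains => //; exact: subvP (chainsS _ _ KL) _ cK.
Qed.

(** The vertices outside [S] are deleted one at a time; each is dominated by a
    vertex of [S], which is still present when its turn comes. *)
Lemma pbetti_restrict K L S U : is_complex K -> is_complex L -> K \subset L ->
    S \subset U ->
    (forall z, exists2 z', z' \in S & dominated_in K z z' /\ dominated_in L z z') ->
  pbetti (restrict K U) (restrict L U) = pbetti (restrict K S) (restrict L S).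
Proof.
move=> Kc Lc KL + tw; have [n] := ubnP #|U|; elim: n U => // n IH U Un SU.
have [->//|] := eqVneq U S.
rewrite eqEsubset SU andbT => /subsetPn[z zU zS].
have deleteE M : delete_vertex z (restrict M U) = restrict M (U :\ z).
  by apply/setP => s; rewrite !inE subsetD1 andbA.
have [z' z'S [twK twL]] := tw z.
have twU M : dominated_in M z z' -> dominated_in (restrict M U) z z'.
  move=> twM s; rewrite !inE => /andP[sM sU] zs; rewrite twM //=.
  by rewrite subUset sub1set (subsetP SU) // sU.
rewrite (@pbetti_delete_vertex z z') ?deleteE; first last.
- exact: twU.
- exact: twU.
- by apply: contraNneq zS => ->.
- by apply/subsetP => s; rewrite !inE => /andP[/(subsetP KL) ->].
- exact: restrict_complex.
- exact: restrict_complex.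
apply: IH; first by rewrite -ltnS (leq_trans _ Un) // (cardsD1 z U) zU.
by rewrite subsetD1 SU.
Qed.

End Deletion.
End PersistentBetti.
(** * Relabelling vertices along a monotone injection *)

Section Relabeling.
Variables (k : fieldType) (d : nat) (X T : finType) (j : X -> T).
Hypothesis j_inj : injective j.
Hypothesis j_mono : forall x y,
  (enum_rank (j x) < enum_rank (j y))%N = (enum_rank x < enum_rank y)%N.
Implicit Types (c : chain k X) (s : {set X}) (t : {set T}) (K L : {set {set X}}).

(** Simplices are oriented by the enumeration of the vertices, so for an
    injection that respects enumeration ranks the induced map on chains carries
    no signs. *)
Definition relabel c : chain k T :=
  [ffun t : {set T} => if t \subset j @: setT then c (j @^-1: t) else 0].

Lemma relabel_is_linear : linear relabel.
Proof.
move=> a c1 c2; apply/ffunP => t; rewrite !ffunE; case: ifP => _ //.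
by rewrite scaler0 addr0.
Qed.

HB.instance Definition _ :=
  GRing.isLinear.Build k (chain k X) (chain k T) _ relabel relabel_is_linear.

Lemma preim_imset s : j @^-1: (j @: s) = s.
Proof. by apply/setP => x; rewrite inE mem_imset. Qed.

Lemma imset_preim t : t \subset j @: setT -> j @: (j @^-1: t) = t.
Proof.
move=> /subsetP tj; apply/setP => y; apply/imsetP/idP => [[x + ->]|yt].
  by rewrite inE.
by have /imsetP[x _ e] := tj _ yt; exists x; rewrite // inE -e.
Qed.

Lemma relabel_imset c s : relabel c (j @: s) = c s.
Proof. by rewrite ffunE imsetS ?subsetT // preim_imset. Qed.

Lemma face_sign_imset s x : face_sign k (j @: s) (j x) = face_sign k s x.
Proof.
rewrite /face_sign; congr (_ ^+ _); rewrite -(card_imset _ j_inj).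
apply: eq_card => y; rewrite !inE; apply/andP/imsetP => [[/imsetP[u us ->]]|].
  by rewrite j_mono => ux; exists u; rewrite // inE us.
by move=> [u]; rewrite inE => /andP[us ux] ->; rewrite j_mono ux imset_f.
Qed.

Lemma bd_relabel c : bd k T (relabel c) = relabel (bd k X c).
Proof.
rewrite !lfunE /= !bd_funE; apply/ffunP => t.
have [tj|tj] := boolP (t \subset j @: setT); last first.
  rewrite [RHS]ffunE (negbTE tj) ffunE; case: ifP => // _.
  rewrite sum_ffunE big1 // => y _; rewrite ffunE; case: ifP => // _.
  by rewrite ffunE subUset (negbTE tj) andbF mulr0.
rewrite -(imset_preim tj) relabel_imset !ffunE imset_eq0.
case: ifP => // _; rewrite !sum_ffunE; set s := j @^-1: t.
rewrite (bigID (mem (j @: setT))) /= [X in _ + X]big1 ?addr0 => [|y yj]; last first.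
  rewrite ffunE; case: ifP => // _.
  by rewrite ffunE subUset sub1set (negbTE yj) mulr0.
rewrite big_imset /=; last by move=> x y _ _; exact: j_inj.
apply: eq_big => [x|x _]; first by rewrite inE.
rewrite !ffunE mem_imset //; case: ifP => // _.
by rewrite face_sign_imset -imsetU1 preim_imset imsetS ?subsetT.
Qed.

Definition relabel_cx K : {set {set T}} := [set j @: s | s : {set X} in K].

Lemma lker_relabel : lker (linfun relabel) = 0%VS.
Proof.
apply/eqP; rewrite -subv0; apply/subvP => c; rewrite memv_ker lfunE memv0 /=.
move=> /eqP c0; apply/eqP/ffunP => s; rewrite -relabel_imset c0.
by rewrite !ffunE.
Qed.

Lemma relabel_chains n K c :
  (relabel c \in chains k n (relabel_cx K)) = (c \in chains k n K).
Proof.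
have imj := imset_inj j_inj.
apply/memv_chains/memv_chains => cK t.
  by have := cK (j @: t); rewrite relabel_imset mem_imset // card_imset.
rewrite ffunE; case: ifP => [tj|]; last by rewrite eqxx.
by move/cK; rewrite -{3 4}(imset_preim tj) mem_imset // card_imset.
Qed.

Lemma relabel_onto n K (c' : chain k T) : c' \in chains k n (relabel_cx K) ->
  exists c, c' = relabel c.
Proof.
move=> /memv_chains cK; exists [ffun s : {set X} => c' (j @: s)].
apply/ffunP => t; rewrite ffunE; case: ifPn => [tj|tj].
  by rewrite ffunE imset_preim.
have [//|/cK/andP[/imsetP[s _ e] _]] := eqVneq (c' t) 0.
by move: tj; rewrite e imsetS // subsetT.
Qed.

Lemma limg_relabel_cycles n K :
  (linfun relabel @: cycles k n K)%VS = cycles k n (relabel_cx K).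
Proof.
apply/eqP; rewrite eqEsubv; apply/andP; split; apply/subvP => c'.
  move=> /memv_imgP[c]; rewrite memv_cap memv_ker => /andP[cK /eqP c0] ->.
  by rewrite lfunE /= memv_cap relabel_chains cK memv_ker bd_relabel c0 linear0 eqxx.
rewrite memv_cap memv_ker => /andP[cK']; have [c e] := relabel_onto cK'.
rewrite {}e in cK' *; rewrite bd_relabel => c0.
apply/memv_imgP; exists c; last by rewrite lfunE.
rewrite memv_cap -relabel_chains cK' memv_ker -memv0 -lker_relabel memv_ker.
by rewrite lfunE.
Qed.

Lemma limg_relabel_boundaries n L :
  (linfun relabel @: boundaries k n L)%VS = boundaries k n (relabel_cx L).
Proof.
apply/eqP; rewrite eqEsubv; apply/andP; split; apply/subvP => c'.
  move=> /memv_imgP[_ /memv_imgP[c cL ->] ->].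
  by rewrite lfunE /= -bd_relabel memv_img // relabel_chains.
move=> /memv_imgP[b]; move=> bL; have [c e] := relabel_onto bL.
rewrite {}e in bL *; rewrite bd_relabel => ->.
by rewrite -[relabel _]lfunE memv_img // memv_img // -relabel_chains.
Qed.

Lemma pbetti_relabel K L :
  pbetti k d (relabel_cx K) (relabel_cx L) = pbetti k d K L.
Proof.
have dimE (U : {vspace chain k X}) : \dim (linfun relabel @: U) = \dim U.
  by apply: limg_dim_eq; rewrite lker_relabel capv0.
have capE (U W : {vspace chain k X}) :
    (linfun relabel @: U :&: linfun relabel @: W = linfun relabel @: (U :&: W))%VS.
  apply/esym/eqP; rewrite eqEsubv limg_cap /=; apply/subvP => x.
  rewrite memv_cap => /andP[/memv_imgP[u uU ->] /memv_imgP[w wW e]].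
  have ew : u = w.
    by apply/eqP; rewrite -subr_eq0 -memv0 -lker_relabel memv_ker linearB /= e subrr.
  by rewrite memv_img // memv_cap uU ew.
by rewrite /pbetti -limg_relabel_cycles -limg_relabel_boundaries capE !dimE.
Qed.

End Relabeling.

(** * Invariance under pullback *)

Section PullbackInvariance.
Variables (k : fieldType) (d : nat).

(** The image of [j] meets every fibre of [p], and vertices in one fibre dominate
    each other in any pullback along [p]; so everything outside the image of [j]
    can be deleted. *)
Lemma pbetti_pullback_relabel (X T V : finType) (j : X -> T) (p : T -> V)
    (K L : {set {set V}}) :
    injective j ->
    (forall x y, (enum_rank (j x) < enum_rank (j y))%N
       = (enum_rank x < enum_rank y)%N) ->
    (forall v, exists x, p (j x) = v) ->
    is_complex K -> is_complex L -> K \subset L ->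
  pbetti k d (pullback p K) (pullback p L) =
  pbetti k d (pullback (p \o j) K) (pullback (p \o j) L).
Proof.
move=> ji jm pj Kc Lc KL.
have ps v : exists z, p z = v by have [x <-] := pj v; exists (j x).
have im M : is_complex M ->
    restrict (pullback p M) (j @: setT) = relabel_cx j (pullback (p \o j) M).
  move=> Mc; apply/setP => t; rewrite inE pullbackP //.
  apply/andP/imsetP => [[/andP[t0 tM] tj]|[s]].
    exists (j @^-1: t); last by rewrite imset_preim.
    by rewrite pullbackP // imset_comp imset_preim // tM -(imset_eq0 j) imset_preim // t0.
  rewrite pullbackP // imset_comp => /andP[s0 sM] ->.
  by rewrite imset_eq0 s0 sM imsetS ?subsetT.
have rT M : restrict (pullback p M) setT = pullback p M.
  by apply/setP => t; rewrite inE subsetT andbT.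
rewrite -[pullback p K]rT -[pullback p L]rT -(pbetti_relabel k d ji jm) -!im //.
have tw M z x : is_complex M -> p (j x) = p z -> dominated_in (pullback p M) z (j x).
  move=> Mc e s; rewrite !pullbackP // => /andP[s0 sM] zs.
  rewrite imsetU1 e (_ : p z |: p @: s = p @: s).
    by rewrite sM andbT; apply/set0Pn; exists (j x); rewrite setU11.
  by apply/setUidPr; rewrite sub1set imset_f.
apply: pbetti_restrict; rewrite ?pullback_complex ?subsetT //.
  apply/subsetP => t; rewrite !pullbackP // => /andP[-> tK].
  exact: subsetP KL _ tK.
move=> z; have [x e] := pj (p z); exists (j x); first by rewrite imset_f.
by split; exact: tw.
Qed.

Lemma enum_rank_index (T : finType) (x : T) : enum_rank x = index x (enum T) :> nat.
Proof.
rewrite -{2}(nth_enum_rank x x) index_uniq ?enum_uniq //.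
by rewrite -cardE; exact: ltn_ord.
Qed.

(** Both injections into a sum are monotone for enumeration ranks because the
    enumeration of the sum is the concatenation of the two enumerations. *)
Lemma enum_sum (A B : finType) :
  enum {: A + B} = map inl (enum A) ++ map inr (enum B).
Proof. by rewrite !enumT [in LHS]unlock. Qed.

Lemma enum_rank_inl (A B : finType) (x y : A) :
  (enum_rank (inl x : A + B) < enum_rank (inl y : A + B))%N
  = (enum_rank x < enum_rank y)%N.
Proof.
have inl_inj : injective (@inl A B) by move=> u v [].
rewrite !enum_rank_index enum_sum !index_cat !map_f ?mem_enum //.
by rewrite !index_map.
Qed.

Lemma enum_rank_inr (A B : finType) (x y : B) :
  (enum_rank (inr x : A + B) < enum_rank (inr y : A + B))%N
  = (enum_rank x < enum_rank y)%N.
Proof.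
have inr_inj : injective (@inr A B) by move=> u v [].
have out u : (inr u : A + B) \in map inl (enum A) = false by apply/negP => /mapP[].
rewrite !enum_rank_index enum_sum !index_cat !out ltn_add2l.
by rewrite !index_map.
Qed.

(** Both complexes are restrictions of one complex on the disjoint union of the
    two vertex sets, to either summand.  Comparing them there, rather than
    through a section of [p], avoids any orientation signs: a section need not
    respect the vertex order, while the two injections do. *)
Lemma pbetti_pullback (V Z : finType) (p : Z -> V) (K L : {set {set V}}) :
    (forall v, exists z, p z = v) -> is_complex K -> is_complex L -> K \subset L ->
  pbetti k d (pullback p K) (pullback p L) = pbetti k d K L.
Proof.
move=> ps Kc Lc KL.
pose q (x : V + Z) := match x with inl v => v | inr z => p z end.
have idE M : is_complex M -> pullback (fun v : V => v) M = M.
  move=> Mc; apply/setP => t; rewrite pullbackP //; last by move=> v; exists v.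
  rewrite imset_id andb_idl // => tM; have [M0 _] := is_complexP _ Mc.
  by apply: contraNneq M0 => <-.
have := @pbetti_pullback_relabel _ _ _ (@inr V Z) q K L.
rewrite -[q \o inr]/p => <- //; first last.
- by move=> x y; exact: enum_rank_inr.
- by move=> u v [].
rewrite (@pbetti_pullback_relabel _ _ _ (@inl V Z)) //; first last.
- by move=> v; exists v.
- by move=> x y; exact: enum_rank_inl.
- by move=> u v [].
by rewrite -[q \o inl]/(fun v : V => v) !idE.
Qed.

End PullbackInvariance.
(** * Moebius inversion along a Galois connection *)

Section MobiusPushforward.
Local Open Scope order_scope.
Variables (d d' : Order.disp_t) (P : finPOrderType d) (Q : finPOrderType d').
Variable f : galois P Q.

Definition gal_bar_r (K : interv Q) : interv P :=
  @Interv _ P (gal_r f (lo K), gal_r f (hi K)) (gal_r_homo f (interv_le K)).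

Lemma gal_barP (I : interv P) (K : interv Q) :
  (gal_bar f I <= K) = (I <= gal_bar_r K).
Proof. by rewrite /Order.le /= /le_interv /lo /hi /= !galP. Qed.

(** The push-forward of the inverse of [h] is the inverse of its pullback along
    the right adjoint, by the adjunction on intervals.  A term depending on the
    lower end point alone only changes the inverse on the diagonal. *)
Lemma mobius_inv_gal_bar (h : interv P -> int) (h' : interv Q -> int)
    (c : Q -> int) (J : interv Q) :
    (forall K, h' K = h (gal_bar_r K) + c (lo K))%R -> J \notin diag Q ->
  mobius_inv h' J = (\sum_(I | gal_bar f I == J) mobius_inv h I)%R.
Proof.
move=> hh' Jd.
pose point q := @Interv _ Q (q, q) (lexx q).
(* The inverse of [h'] on all intervals: on the diagonal, the correction is the
   inverse of [c] on the poset of end points. *)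
pose D K := (\sum_(I | gal_bar f I == K) mobius_inv h I
             + (if K \in diag Q then mobius_inv c (lo K) else 0))%R.
suff <- : D =1 mobius_inv h' by rewrite /D (negbTE Jd) addr0.
apply: mobius_inv_uniq => K; rewrite hh' /D big_split /=; congr (_ + _)%R.
  rewrite (mobius_invP h) (partition_big (gal_bar f) (fun J => J <= K)) /=.
    apply: eq_bigr => L LK; apply: eq_bigl => I.
    by rewrite andb_idl // => /eqP e; rewrite -gal_barP e.
  by move=> I; rewrite gal_barP.
rewrite (mobius_invP c) -big_mkcondr /=.
rewrite (reindex_onto point (@lo _ Q)) /=.
  apply: eq_bigl => q; rewrite /Order.le /= /le_interv /lo /hi /= !inE !eqxx !andbT.
  by apply/idP/andP => [qK|[]//]; split=> //; apply: le_trans qK (interv_le K).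
move=> L /andP[_]; rewrite inE => /eqP e; apply: val_inj => /=.
by rewrite [RHS]surjective_pairing; congr pair; exact: e.
Qed.

End MobiusPushforward.

(** * The functor of persistence diagrams *)

Section PersistenceDiagramFunctor.
Variables (R : realType) (k : fieldType) (d : nat).

Lemma ZB_pbetti (F : filtration R) (I : interv (fil_idx F)) :
  (ZB k d I)%:Z =
  (\dim (cycles k d (F (lo I))))%:Z - (pbetti k d (F (lo I)) (F (hi I)))%:Z.
Proof. by rewrite subzn ?leq_subr // subKn // dimvS // capvSl. Qed.

(** Both sides are invariant under pullback, and the two filtrations have the
    same pullback to the vertex set of the morphism. *)
Lemma pbetti_fil_hom (F G : filtration R) (m : fil_hom F G) r r' : r <= r' ->
  pbetti k d (G r) (G r') =
  pbetti k d (F (gal_r (fil_gal m) r)) (F (gal_r (fil_gal m) r')).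
Proof.
move=> rr'.
rewrite -(pbetti_pullback k d (@fil_pr_surj _ _ _ m)) ?fil_complex ?fil_mono //.
rewrite !fil_homP pbetti_pullback ?fil_complex ?fil_mono //.
  exact: fil_pl_surj.
exact: gal_r_homo.
Qed.

Lemma PD_pushforward (F G : filtration R) (m : fil_hom F G)
    (J : interv (fil_idx G)) : J \notin diag (fil_idx G) ->
  PD k d G J =
  (\sum_(I : interv (fil_idx F) | gal_bar (fil_gal m) I == J) PD k d F I)%N.
Proof.
move=> Jd; apply/eqP; rewrite -eqz_nat PDE -natz natr_sum; apply/eqP.
under eq_bigr do rewrite natz PDE.
apply: (mobius_inv_gal_bar (c := fun r => (\dim (cycles k d (G r)))%:Z -
   (\dim (cycles k d (F (gal_r (fil_gal m) r))))%:Z)) => // K.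
rewrite !ZB_pbetti (pbetti_fil_hom m (interv_le K)).
by rewrite [RHS]addrC addrA subrK.
Qed.

Definition PD_hom (F G : filtration R) (m : fil_hom F G) :
  dgm_hom (PD k d F) (PD k d G) :=
  @DgmHom R (PD k d F) (PD k d G) (fil_gal m) (PD_pushforward m).

Lemma PD_functor : @is_functor (Fil R) (Dgm R) (@PD k R d) PD_hom.
Proof. by split=> // A B m n []. Qed.

Lemma ler_dist_maxr (a b a' b' M : R) : `|a - a'| <= M -> `|b - b'| <= M ->
  `|Num.max a b - Num.max a' b'| <= M.
Proof.
rewrite !ler_distlC => /andP[h1 h2] /andP[h3 h4]; apply/andP; split.
  rewrite lerBlDr ge_max -!lerBlDr.
  by apply/andP; split; rewrite le_max ?h1 ?h3 ?orbT.
rewrite ge_max.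
apply/andP; split; [apply: le_trans h2 _|apply: le_trans h4 _];
  by rewrite lerD2r le_max lexx ?orbT.
Qed.

Lemma PD_cost (F G : Fil R) (m : cat_hom F G) :
  @dgm_cost R (PD k d F) (PD k d G) (PD_hom m) <= fil_cost m.
Proof.
have le_cost q q' : `| `|val q - val q'| -
   `|val (fil_gal (m : fil_hom F G) q) - val (fil_gal (m : fil_hom F G) q')| |
   <= fil_cost m.
  apply: le_trans (le_bigmax _ _ q).
  exact: (le_bigmax _ (fun q' => `| `|val q - val q'| - _ |) q').
have cost0 : 0 <= fil_cost m by exact: bigmax_ge_id.
apply: bigmax_le => // I _; apply: bigmax_le => // J _.
by apply: ler_dist_maxr; exact: le_cost.
Qed.

End PersistenceDiagramFunctor.

(** * Edit distances and functors that do not increase costs *)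

Section NonexpansiveFunctors.
Variables (R : realType) (C D : category).
Variables (costC : forall A B : C, cat_hom A B -> R).
Variables (costD : forall A B : D, cat_hom A B -> R).
Variables (Fo : C -> D) (Fm : forall A B : C, cat_hom A B -> cat_hom (Fo A) (Fo B)).
Hypothesis Fm_cost : forall A B (m : cat_hom A B), costD (Fm m) <= costC m.

Definition map_step A B (s : step A B) : step (Fo A) (Fo B) :=
  match s with forward m => forward (Fm m) | backward m => backward (Fm m) end.

Fixpoint map_zigzag A B (z : zigzag A B) : zigzag (Fo A) (Fo B) :=
  match z with
  | one_step s => one_step (map_step s)
  | more_steps _ s z' => more_steps (map_step s) (map_zigzag z')
  end.

Lemma map_zigzag_cost A B (z : zigzag A B) :
  zigzag_cost costD (map_zigzag z) <= zigzag_cost costC z.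
Proof.
have sP A' B' (s : step A' B') : step_cost costD (map_step s) <= step_cost costC s.
  by case: s => m /=; exact: Fm_cost.
by elim: z => [A' B' s|A' B' E s z IH] /=; [exact: sP|exact: lerD].
Qed.

Lemma edit_dist_map A B :
  (edit_dist costD (Fo A) (Fo B) <= edit_dist costC A B)%E.
Proof.
apply: le_ereal_inf_tmp => _ [z ->].
apply: ge_ereal_inf; exists (zigzag_cost costD (map_zigzag z))%:E.
  by exists (map_zigzag z).
by rewrite lee_fin map_zigzag_cost.
Qed.

End NonexpansiveFunctors.

Theorem proposition5p1p11 (R : realType) (k : fieldType) (d : nat) :
  (exists PDm : forall F G : Fil R,
                  cat_hom F G -> @cat_hom (Dgm R) (PD k d F) (PD k d G),
      (forall (F G : Fil R) (m : cat_hom F G),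
         dgm_gal (PDm F G m) = fil_gal m :> galois (fil_idx F) (fil_idx G)) /\
      @is_functor (Fil R) (Dgm R) (@PD k R d) PDm) /\
  (forall F G : Fil R,
     (edit_dist (@dgm_cost R) (PD k d F) (PD k d G) <= edit_dist (@fil_cost R) F G)%E).
Proof.
split; first by exists (@PD_hom R k d); split=> //; exact: PD_functor.
move=> F G.
exact: (@edit_dist_map R (Fil R) (Dgm R) (@fil_cost R) (@dgm_cost R)
  (@PD k R d) (@PD_hom R k d) (@PD_cost R k d)).
Qed.
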